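(* Let $D_G$ be a weighted oriented graph with underlying graph $G$ on vertices $x_1,\ldots,x_n$ and let $I=I(D_G)$. Suppose the complement graph $\overline G$ is chordal and that $D_G$ satisfies property $(\ast)$ with respect to a perfect elimination ordering of $\overline G$. Then $I^{\vee}$ is Cohen-Macaulay, i.e. $K[x_1,\ldots,x_n]/I^{\vee}$ is Cohen-Macaulay.
   Context: A weighted oriented graph $D_G$ with underlying simple graph $G$ is an orientation of the edges with weights $w(k)=w(x_k)\in\mathbb{Z}_{>0}$; $(x_i,x_j)$ denotes an edge oriented from $x_i$ to $x_j$; a sink is a vertex all of whose edges point towards it; sources have weight $1$ by convention. $I(D_G)=\langle x_ix_j^{w(j)}:(x_i,x_j)\in E(D_G)\rangle\subseteq K[x_1,\ldots,x_n]$, $K$ a field. A graph is chordal if every induced cycle of length $\ge4$ has a chord. A vertex is simplicial if it and its neighbours induce a complete graph; a perfect elimination ordering of a graph is a linear ordering $(v_1,\ldots,v_n)$ of its vertices such that each $v_i$ is simplicial in the subgraph induced by $\{v_1,\ldots,v_i\}$. Property $(\ast)$ w.r.t. such an ordering of $\overline G$: whenever $x_j$ appears before $x_i$ in the ordering and $\{x_j,x_i\}\notin E(G)$, then for every non-sink vertex $x_k$ with $w(k)\ne1$ and $(x_k,x_i)\notin E(D_G)$ we have $(x_k,x_j)\notin E(D_G)$. Alexander dual (Miller): for $\mathbf b\in\mathbb N^n$, $\mathbf m^{\mathbf b}=\langle x_i^{b_i}:b_i\ge1\rangle$; $\mathrm{Irr}(I)$ is the set of irreducible components in the irredundant irreducible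 decomposition of $I$; $\mathbf a_I$ is the exponent vector of the lcm of the minimal generators of $I$; for $\mathbf 0\preceq\mathbf b\preceq\mathbf a$, $(\mathbf b^{\mathbf a})_i=a_i+1-b_i$ if $b_i\ge1$ and $0$ otherwise; $I^{\vee}=\langle\mathbf x^{\mathbf b^{\mathbf a_I}}:\mathbf m^{\mathbf b}\in\mathrm{Irr}(I)\rangle$. *)

(* Defs.v *)
From HB Require Import structures.
From mathcomp Require Import all_boot all_order all_algebra.
From mathcomp Require Import mpoly.
Set Implicit Arguments.
Unset Strict Implicit.
Unset Printing Implicit Defensive.
Import GRing.Theory.
Local Open Scope ring_scope.

Definition simple_graph (n : nat) (G : rel 'I_n) : Prop :=
  (forall i, ~~ G i i) /\ (forall i j, G i j = G j i).

Definition compl_graph (n : nat) (G : rel 'I_n) : rel 'I_n :=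
  fun i j => (i != j) && ~~ G i j.

(* D i j means (x_i, x_j) is an oriented edge, from x_i to x_j.
   D is an orientation of G: every edge of G gets exactly one direction. *)
Definition orientation_of (n : nat) (G D : rel 'I_n) : Prop :=
  (forall i j, D i j -> G i j) /\
  (forall i j, G i j -> (D i j && ~~ D j i) || (D j i && ~~ D i j)).

Definition is_sink (n : nat) (G D : rel 'I_n) (k : 'I_n) : Prop :=
  forall j, G j k -> D j k.

Definition is_source (n : nat) (G D : rel 'I_n) (k : 'I_n) : Prop :=
  forall j, G k j -> D k j.

Definition weighted_oriented (n : nat) (G D : rel 'I_n) (w : 'I_n -> nat) : Prop :=
  simple_graph G /\ orientation_of G D /\
  (forall i, 0 < w i)%N /\ (forall i, is_source G D i -> w i = 1%N).

Definition chordal (n : nat) (E : rel 'I_n) : Prop :=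
  forall c : seq 'I_n, uniq c -> (4 <= size c)%N -> cycle E c ->
    exists u v, [/\ u \in c, v \in c, u != v,
       (next c u != v) && (next c v != u) & E u v].

Definition ordering (n : nat) (s : seq 'I_n) : Prop := perm_eq s (enum 'I_n).

Definition perfect_elimination_ordering (n : nat) (E : rel 'I_n) (s : seq 'I_n) : Prop :=
  ordering s /\
  forall v u1 u2, (index u1 s < index v s)%N -> (index u2 s < index v s)%N ->
    E u1 v -> E u2 v -> u1 != u2 -> E u1 u2.

Definition property_star (n : nat) (G D : rel 'I_n) (w : 'I_n -> nat)
    (s : seq 'I_n) : Prop :=
  forall i j, (index j s < index i s)%N -> j != i -> ~~ G j i ->
    forall k, ~ is_sink G D k -> w k <> 1%N -> ~~ D k i -> ~~ D k j.

Definition ideal_of (K : fieldType) (n : nat) := {mpoly K[n]} -> Prop.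

Definition gen_ideal (K : fieldType) (n : nat) (gs : seq {mpoly K[n]}) : ideal_of K n :=
  fun f => exists cs : seq {mpoly K[n]}, f = \sum_(i < size gs) cs`_i * gs`_i.

Definition monom (K : fieldType) (n : nat) (e : {ffun 'I_n -> nat}) : {mpoly K[n]} :=
  \prod_(i < n) 'X_i ^+ e i.

(* the edge ideal I(D_G) = < x_i x_j^{w(j)} : (x_i,x_j) in E(D_G) > *)
Definition edge_exps (n : nat) (D : rel 'I_n) (w : 'I_n -> nat) : seq {ffun 'I_n -> nat} :=
  [seq [ffun k : 'I_n => ((k == p.1) + (k == p.2) * w p.2)%N]
     | p <- [seq (i, j) | i <- enum 'I_n, j <- enum 'I_n] & D p.1 p.2].

Definition edge_ideal (K : fieldType) (n : nat) (D : rel 'I_n) (w : 'I_n -> nat)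
  : ideal_of K n :=
  gen_ideal [seq @monom K n e | e <- edge_exps D w].

Definition exp_le (n : nat) (e f : {ffun 'I_n -> nat}) : bool := [forall i, e i <= f i]%N.

Definition minimal_exps (n : nat) (gs : seq {ffun 'I_n -> nat}) : seq {ffun 'I_n -> nat} :=
  [seq e <- gs | ~~ has (fun f => exp_le f e && ~~ exp_le e f) gs].

Definition lcm_exp (n : nat) (gs : seq {ffun 'I_n -> nat}) : {ffun 'I_n -> nat} :=
  [ffun i => \max_(e <- minimal_exps gs) e i].

Definition mpow (K : fieldType) (n : nat) (b : {ffun 'I_n -> nat}) : ideal_of K n :=
  gen_ideal [seq 'X_i ^+ b i | i <- enum 'I_n & (0 < b i)%N].

Definition irredundant_irreducible_decomposition (K : fieldType) (n : nat)
    (I : ideal_of K n) (B : seq {ffun 'I_n -> nat}) : Prop :=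
  uniq B /\
  (forall f, I f <-> (forall b, b \in B -> @mpow K n b f)) /\
  (forall b0, b0 \in B -> ~ (forall f, I f <-> (forall b, b \in rem b0 B -> @mpow K n b f))) /\
  (forall b0, b0 \in B -> forall b1, b1 \in B -> b0 != b1 ->
      exists f, ~ (@mpow K n b0 f <-> @mpow K n b1 f)).

Definition dual_exp (n : nat) (a b : {ffun 'I_n -> nat}) : {ffun 'I_n -> nat} :=
  [ffun i => if (1 <= b i)%N then (a i + 1 - b i)%N else 0%N].

(* Alexander dual I^vee = < x^{b^{a_I}} : m^b in Irr(I) > *)
Definition alexander_dual (K : fieldType) (n : nat) (a : {ffun 'I_n -> nat})
    (B : seq {ffun 'I_n -> nat}) : ideal_of K n :=
  gen_ideal [seq @monom K n (dual_exp a b) | b <- B].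

Definition is_ideal (K : fieldType) (n : nat) (P : ideal_of K n) : Prop :=
  P 0 /\ (forall f g, P f -> P g -> P (f + g)) /\ (forall f g, P g -> P (f * g)).

Definition is_prime_ideal (K : fieldType) (n : nat) (P : ideal_of K n) : Prop :=
  is_ideal P /\ ~ P 1 /\ (forall f g, P (f * g) -> P f \/ P g).

Definition prime_chain (K : fieldType) (n : nat) (J : ideal_of K n) (d : nat)
    (P : nat -> ideal_of K n) : Prop :=
  (forall i, (i <= d)%N -> is_prime_ideal (P i) /\ (forall f, J f -> P i f)) /\
  (forall i, (i < d)%N -> (forall f, P i f -> P i.+1 f) /\ exists f, P i.+1 f /\ ~ P i f).

Definition krull_dim_quot (K : fieldType) (n : nat) (J : ideal_of K n) (d : nat) : Prop :=
  (exists P, prime_chain J d P) /\ ~ (exists P, prime_chain J d.+1 P).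

Definition ideal_add (K : fieldType) (n : nat) (J : ideal_of K n) (fs : seq {mpoly K[n]})
  : ideal_of K n :=
  fun h => exists j, J j /\ gen_ideal fs (h - j).

Definition max_ideal (K : fieldType) (n : nat) : ideal_of K n :=
  gen_ideal [seq 'X_i | i <- enum 'I_n].

Definition regular_sequence (K : fieldType) (n : nat) (J : ideal_of K n)
    (fs : seq {mpoly K[n]}) : Prop :=
  (forall f, f \in fs -> @max_ideal K n f) /\
  (forall i, (i < size fs)%N -> forall g,
      ideal_add J (take i fs) (g * fs`_i) -> ideal_add J (take i fs) g) /\
  ~ ideal_add J fs 1.

Definition depth_quot (K : fieldType) (n : nat) (J : ideal_of K n) (d : nat) : Prop :=
  (exists fs, size fs = d /\ regular_sequence J fs) /\
  ~ (exists fs, size fs = d.+1 /\ regular_sequence J fs).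

(* K[x]/J is Cohen-Macaulay: depth = Krull dimension (J homogeneous) *)
Definition cohen_macaulay_quot (K : fieldType) (n : nat) (J : ideal_of K n) : Prop :=
  exists d, krull_dim_quot J d /\ depth_quot J d.

(* Main.v *)
Require Import Defs.
From mathcomp Require Import all_boot all_order all_algebra.
From mathcomp Require Import mpoly.
From mathcomp Require Import ring zify.

Set Implicit Arguments.
Unset Strict Implicit.
Unset Printing Implicit Defensive.
Import GRing.Theory.
Local Open Scope ring_scope.

(* The dual J is the intersection of the ideals <x_i^w(i), x_j> over the edges
   (x_i, x_j), so it has codimension 2.  Up to polarization J is the vertex
   cover ideal of a graph whose complement is chordal, and property (star) says
   exactly that the given ordering, preceded by the clones of the weighted
   vertices, is a perfect elimination ordering of that complement.  Adding the
   vertices one at a time gives ideals J_(k+1) with J_(k+1) : x_v = J_k and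
   J_(k+1) + x_v = <x_v, monomial>, so R/J is filtered by the rings
   R/<x_i, x_j>.  The elementary symmetric polynomials e_(n-2), ..., e_1 form a
   regular sequence on each of these over any field, hence on R/J.
   Conversely, n-1 polynomials are algebraically dependent modulo J, by counting
   monomials, and a dependence relation rules out both a regular sequence and a
   chain of primes of length n-1. *)

(** * Weakly regular sequences, and polynomial relations modulo an ideal *)

Section Ideals.
Variables (K : fieldType) (n : nat).
Implicit Types (J L : ideal_of K n) (f g h : {mpoly K[n]}).

Lemma ideal0 J : is_ideal J -> J 0. Proof. by case. Qed.

Lemma idealD J f g : is_ideal J -> J f -> J g -> J (f + g).
Proof. by case=> _ [hD _]; apply: hD. Qed.

Lemma idealMleft J f g : is_ideal J -> J g -> J (f * g).
Proof. by case=> _ [_ hM]; apply: hM. Qed.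

Lemma idealMright J f g : is_ideal J -> J g -> J (g * f).
Proof. by move=> hJ Jg; rewrite mulrC; apply: idealMleft. Qed.

Lemma idealN J f : is_ideal J -> J f -> J (- f).
Proof. by move=> hJ Jf; rewrite -mulN1r; apply: idealMleft. Qed.

Lemma idealB J f g : is_ideal J -> J f -> J g -> J (f - g).
Proof. by move=> hJ Jf Jg; apply: idealD => //; apply: idealN. Qed.

Lemma idealZ J (c : K) f : is_ideal J -> J f -> J (c *: f).
Proof. by move=> hJ Jf; rewrite -mul_mpolyC; apply: idealMleft. Qed.

Lemma ideal_sum J (T : eqType) (r : seq T) (F : T -> {mpoly K[n]}) :
  is_ideal J -> (forall i, i \in r -> J (F i)) -> J (\sum_(i <- r) F i).
Proof.
move=> hJ hF; rewrite big_seq_cond; apply: big_ind.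
- exact: ideal0.
- by move=> f g; apply: idealD.
- by move=> i; rewrite andbT; apply: hF.
Qed.

Lemma gen_idealP (gs : seq {mpoly K[n]}) J :
  is_ideal J -> (forall g, g \in gs -> J g) -> forall f, gen_ideal gs f -> J f.
Proof.
move=> hJ hg f [cs ->]; apply: ideal_sum => // i _.
by apply: idealMleft => //; apply: hg; apply: mem_nth.
Qed.

Lemma gen_ideal_is_ideal (gs : seq {mpoly K[n]}) : is_ideal (gen_ideal gs).
Proof.
split; first by exists [::]; rewrite big1 // => i _; rewrite nth_nil mul0r.
split=> [f g [cs ->] [ds ->]|f g [cs ->]].
  exists (mkseq (fun i => cs`_i + ds`_i) (size gs)).
  rewrite -big_split; apply: eq_bigr => i _ /=.
  by rewrite nth_mkseq // mulrDl.
exists (mkseq (fun i => f * cs`_i) (size gs)).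
rewrite big_distrr; apply: eq_bigr => i _ /=.
by rewrite nth_mkseq // mulrA.
Qed.

Lemma mem_gen_ideal (gs : seq {mpoly K[n]}) g : g \in gs -> gen_ideal gs g.
Proof.
move=> gin; exists (mkseq (fun i => (i == index g gs)%:R) (size gs)).
have lt : (index g gs < size gs)%N by rewrite index_mem.
rewrite (bigD1 (Ordinal lt)) //= nth_mkseq // eqxx mul1r nth_index // big1 ?addr0 //.
move=> i; rewrite -val_eqE /= => /negPf ne.
by rewrite nth_mkseq // ne mul0r.
Qed.

Definition addI J f : ideal_of K n := fun h => exists c, J (h - c * f).

Definition colon J f : ideal_of K n := fun h => J (h * f).

Lemma addI_ideal J f : is_ideal J -> is_ideal (addI J f).
Proof.
move=> hJ; split; first by exists 0; rewrite mul0r subr0; apply: ideal0.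
split=> [g h [c Jg] [d Jh]|g h [c Jh]].
  exists (c + d); have -> : g + h - (c + d) * f = (g - c * f) + (h - d * f) by ring.
  exact: idealD.
exists (g * c); have -> : g * h - g * c * f = g * (h - c * f) by ring.
exact: idealMleft.
Qed.

Lemma addI_sub J f h : J h -> addI J f h.
Proof. by exists 0; rewrite mul0r subr0. Qed.

Lemma addI_gen J f : is_ideal J -> addI J f f.
Proof. by exists 1; rewrite mul1r subrr; apply: ideal0. Qed.

(** Properness of the final ideal is left out, so that the zero ring is a harmless term of a
    filtration. *)
Fixpoint wreg J (fs : seq {mpoly K[n]}) : Prop :=
  if fs is f :: fs' then (forall g, J (g * f) -> J g) /\ wreg (addI J f) fs'
  else True.

Lemma wreg_ext J L fs : (forall h, J h <-> L h) -> wreg J fs -> wreg L fs.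
Proof.
elim: fs J L => //= f fs IH J L E [nzd reg]; split=> [g /E /nzd /E //|].
apply: IH reg => h.
by split=> -[c hc]; exists c; apply/E.
Qed.

Lemma wreg_full J fs : (forall h, J h) -> wreg J fs.
Proof.
elim: fs J => //= f fs IH J hJ; split=> //; apply: IH => h.
by exists 0.
Qed.

(* The horseshoe for 0 -> R/(J : m) -> R/J -> R/(J + m) -> 0: the regularity of
   f on R/(J + m) gives ((J + f) : m) = (J : m) + f, so the sequence stays
   exact modulo f. *)
Lemma wreg_extension J m fs :
  is_ideal J -> wreg (colon J m) fs -> wreg (addI J m) fs -> wreg J fs.
Proof.
elim: fs J => //= f fs IH J hJ [nzd1 reg1] [nzd2 reg2]; split=> [g Jgf|].
  (* Modulo [J], [g] is [c * m]; then [c * f] lies in [J : m], hence so does [c], and [c * m] lies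
     in [J]. *)
  have [c hc] := nzd2 _ (addI_sub m Jgf).
  have : colon J m c.
    apply: nzd1; rewrite /colon.
    have -> : c * f * m = g * f - f * (g - c * m) by ring.
    by apply: idealB => //; apply: idealMleft.
  rewrite /colon => Jcm; have -> : g = (g - c * m) + c * m by ring.
  exact: idealD.
apply: IH; first exact: addI_ideal.
  apply: wreg_ext reg1 => h; rewrite /colon; split=> -[a ha].
    exists (a * m); have -> : h * m - a * m * f = (h - a * f) * m by ring.
    exact: ha.
  (* From [h * m = a * f] modulo [J], regularity of [f] modulo [J + m] yields [a = c * m] modulo
     [J]; then [h - c * f] lies in [J : m]. *)
  have /nzd2 [c hc] : addI J m (a * f).
    exists h; have -> : a * f - h * m = - (h * m - a * f) by ring.
    exact: idealN.
  exists c; have -> : (h - c * f) * m = (h * m - a * f) + f * (a - c * m) by ring.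
  by apply: idealD => //; apply: idealMleft.
apply: wreg_ext reg2 => h; split=> -[c [d hd]]; exists d, c.
  by rewrite addrAC.
by rewrite addrAC.
Qed.

Lemma ideal_add_nil J h : is_ideal J -> ideal_add J [::] h <-> J h.
Proof.
move=> hJ; split=> [[j [Jj [cs]]]|Jh].
  by rewrite big_ord0 => /eqP; rewrite subr_eq0 => /eqP ->.
by exists h; split=> //; exists [::]; rewrite big_ord0 subrr.
Qed.

Lemma ideal_add_cons J f fs h :
  ideal_add J (f :: fs) h <-> ideal_add (addI J f) fs h.
Proof.
split=> [[j [Jj [cs E]]]|[j [[c Jj] [cs E]]]].
  exists (j + cs`_0 * f); split; first by exists cs`_0; rewrite addrK.
  exists (behead cs); rewrite opprD addrA E big_ord_recl /= addrC addKr.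
  by apply: eq_bigr => i _; rewrite nth_behead.
exists (j - c * f); split=> //; exists (c :: cs).
rewrite big_ord_recl /= /bump /=.
have -> : h - (j - c * f) = c * f + (h - j) by ring.
by congr (_ + _).
Qed.

Lemma wregP J fs : is_ideal J ->
  wreg J fs <-> (forall i, (i < size fs)%N -> forall g,
      ideal_add J (take i fs) (g * fs`_i) -> ideal_add J (take i fs) g).
Proof.
elim: fs J => //= f fs IH J hJ; have hJf := addI_ideal f hJ.
split=> [[nzd /(IH _ hJf) reg] [|i] lt g|reg].
- by rewrite take0 !ideal_add_nil //; apply: nzd.
- by rewrite /= !ideal_add_cons; apply: reg.
split=> [g|].
  by have := reg 0%N isT g; rewrite take0 !ideal_add_nil.
apply/IH => // i lt g; rewrite -!ideal_add_cons; exact: (reg i.+1).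
Qed.

(* [chain J fs] is implied both by fs being a regular sequence on R/J and by
   the f_i separating the successive terms of a chain of primes above J. *)
Fixpoint chain J (fs : seq {mpoly K[n]}) : Prop :=
  if fs is f :: fs' then
    (forall g, J (g * f) -> J g) /\
    exists L, [/\ is_ideal L, (forall h, J h -> L h), L f & chain L fs']
  else ~ J 1.

Lemma chain_wreg J fs : is_ideal J -> wreg J fs -> ~ ideal_add J fs 1 -> chain J fs.
Proof.
elim: fs J => [|f fs IH] J hJ /=; first by rewrite ideal_add_nil.
move=> [nzd reg]; rewrite ideal_add_cons => n1; split=> //.
exists (addI J f); split.
- exact: addI_ideal.
- by move=> h; apply: addI_sub.
- exact: addI_gen.
- by apply: IH => //; apply: addI_ideal.
Qed.

Fixpoint fpow (fs : seq {mpoly K[n]}) (e : seq nat) : {mpoly K[n]} :=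
  if fs is f :: fs' then f ^+ head 0%N e * fpow fs' (behead e) else 1.

Fixpoint exps (N r : nat) : seq (seq nat) :=
  if r is r'.+1 then [seq a :: e | a <- iota 0 N, e <- exps N r'] else [:: [::]].

Lemma size_exps N r : size (exps N r) = (N ^ r)%N.
Proof. by elim: r => //= r IH; rewrite size_allpairs size_iota IH expnS. Qed.

Lemma uniq_exps N r : uniq (exps N r).
Proof.
elim: r => //= r IH; apply: allpairs_uniq => //; first exact: iota_uniq.
by move=> [a e] [b f] _ _ /= [-> ->].
Qed.

Lemma exps_lt N r e : e \in exps N r -> forall i, (0 < N)%N -> (nth 0%N e i < N)%N.
Proof.
elim: r e => [|r IH] e /=.
  by rewrite inE => /eqP -> i; rewrite nth_nil.
move=> /allpairsP [[a f] /= [aN fin ->]] [|i] N0 /=.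
  by move: aN; rewrite mem_iota.
exact: IH.
Qed.

(* Only a polynomial relation with zero coefficients can hold modulo J: the
   constant term in the first variable vanishes modulo the next ideal of the
   chain, and otherwise a factor of f can be cancelled. *)
Lemma chain_independent N fs J (c : seq nat -> K) :
  is_ideal J -> chain J fs ->
  J (\sum_(e <- exps N (size fs)) c e *: fpow fs e) ->
  forall e, e \in exps N (size fs) -> c e = 0.
Proof.
elim: fs J c => [|f fs IH] J c hJ /=.
  move=> J1; rewrite big_seq1 => Jc e; rewrite inE => /eqP ->.
  have [//|c0] := eqVneq (c [::]) 0; case: J1.
  by rewrite -[1](scalerK c0); apply: idealZ.
move=> [nzd [L [hL JL Lf ch]]]; rewrite big_allpairs_dep /=.
pose S d := \sum_(e <- exps N (size fs)) d e *: fpow fs e.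
(* The number [M] of powers of [f] is decoupled from the bound [N] on the other exponents, so that
   cancelling [f] lowers [M] alone. *)
have main M (d : nat -> seq nat -> K) :
  J (\sum_(0 <= a < M) f ^+ a * S (d a)) ->
  forall a e, (a < M)%N -> e \in exps N (size fs) -> d a e = 0.
  elim: M d => // M IHM d; rewrite big_nat_recl // expr0 mul1r => Jd.
  pose T := \sum_(0 <= a < M) f ^+ a * S (d a.+1).
  have ET : \sum_(0 <= a < M) f ^+ a.+1 * S (d a.+1) = T * f.
    by rewrite mulr_suml; apply: eq_bigr => a _; rewrite exprS; ring.
  rewrite ET in Jd.
  have d0 : forall e, e \in exps N (size fs) -> d 0%N e = 0.
    apply: (IH L) => //; rewrite -/(S (d 0%N)).
    have -> : S (d 0%N) = (S (d 0%N) + T * f) - T * f by ring.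
    by apply: idealB => //; [apply: JL | apply: idealMleft].
  have S0 : S (d 0%N) = 0.
    by rewrite /S big_seq big1 // => e ein; rewrite d0 // scale0r.
  move: Jd; rewrite S0 add0r => /nzd JT [|a] e lt ein; first exact: d0.
  exact: (IHM (fun a => d a.+1)).
move=> Jc e /allpairsP [[a e'] /= [aN ein ->]].
apply: (main N (fun a e => c (a :: e))) => //; last by move: aN; rewrite mem_iota.
rewrite /index_iota subn0; congr (J _): Jc.
apply: eq_bigr => b _; rewrite /S mulr_sumr; apply: eq_bigr => x _.
by rewrite scalerAr.
Qed.

End Ideals.

(** * Monomial ideals, and elementary symmetric polynomials modulo variables *)

Section MonomialIdeals.
Variables (K : fieldType) (n : nat).
Implicit Types (f g h : {mpoly K[n]}) (m : 'X_{1..n}) (U V : pred 'X_{1..n}).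
Implicit Types (S : {set 'I_n}).

(** Membership is read on the support, so that taking the colon by a monomial or adding one becomes
    an operation on exponent predicates. *)
Definition mideal U : ideal_of K n := fun f => forall m, m \in msupp f -> U m.

Definition upset U : Prop := forall m m', U m -> U (m + m')%MM.

Lemma mideal_ext U V : U =1 V -> forall h, mideal U h <-> mideal V h.
Proof. by move=> E h; split=> hU m /hU; rewrite E. Qed.

Lemma mideal_is_ideal U : upset U -> is_ideal (mideal U).
Proof.
move=> up; split; first by move=> m; rewrite msupp0.
split=> [f g Uf Ug m /msuppD_le|f g Ug m /msuppM_le].
  by rewrite mem_cat => /orP[/Uf|/Ug].
by case/allpairsP=> -[a b] /= [_ /Ug Ub ->]; rewrite addmC; apply: up.
Qed.

Lemma midealX U m : mideal U 'X_[m] <-> U m.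
Proof.
split=> [|Um m']; first by apply; rewrite msuppX mem_seq1.
by rewrite msuppX mem_seq1 => /eqP ->.
Qed.

Lemma colon_mideal U m h :
  colon (mideal U) 'X_[m] h <-> mideal (fun m' => U (m + m')%MM) h.
Proof.
rewrite /colon; split=> hU m'.
  by move=> m'h; apply: hU; rewrite (perm_mem (msuppMX _ _)); apply/mapP; exists m'.
by rewrite (perm_mem (msuppMX _ _)) => /mapP[m2 /hU ? ->].
Qed.

Lemma addI_mideal U m h : upset U ->
  addI (mideal U) 'X_[m] h <-> mideal (fun m' => U m' || (m <= m')%MM) h.
Proof.
move=> up; have up' : upset (fun m' => U m' || (m <= m')%MM).
  move=> a b /orP[/(up _ b) -> //|le]; apply/orP; right.
  by apply: lepm_trans le (lem_addr _ _).
have hI := mideal_is_ideal up'.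
split=> [[c Uh]|Uh].
  have -> : h = (h - c * 'X_[m]) + c * 'X_[m] by ring.
  apply: (idealD hI); first by move=> m' /Uh ->.
  by apply: (idealMleft _ hI); apply/midealX; rewrite lepm_refl orbT.
have aI := addI_ideal 'X_[m] (mideal_is_ideal up).
rewrite [h]mpolyE; apply: (ideal_sum aI) => m' /Uh /orP[Um|le].
  by apply: addI_sub; apply: (idealZ _ (mideal_is_ideal up)); apply/midealX.
rewrite -(submK le) addmC mpolyXD; apply: (idealZ _ aI); apply: (idealMright _ aI).
by apply: addI_gen; apply: mideal_is_ideal.
Qed.

Lemma addI_congr J f g h : is_ideal J -> J (f - g) -> addI J f h -> addI J g h.
Proof.
move=> hJ Jfg [c Jc]; exists c.
have -> : h - c * g = (h - c * f) + c * (f - g) by ring.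
by apply: idealD => //; apply: idealMleft.
Qed.

Definition meets S : pred 'X_{1..n} := fun m => [exists i in S, (0 < m i)%N].

Lemma meets_upset S : upset (meets S).
Proof.
move=> a b /exists_inP[i iS lt]; apply/exists_inP; exists i => //.
by rewrite mnmDE addn_gt0 lt.
Qed.

Definition prime_of S : ideal_of K n := mideal (meets S).

(** The kernel of this substitution is [prime_of S], which is therefore prime because the polynomial
    ring is a domain. *)
Definition kill S : {mpoly K[n]} -> {mpoly K[n]} :=
  comp_mpoly [tuple if i \in S then 0 else 'X_i | i < n].

Lemma killX S m : kill S 'X_[m] = if meets S m then 0 else 'X_[m].
Proof.
rewrite /kill comp_mpolyX; case: ifPn => [/exists_inP[i iS lt]|].
  by rewrite (bigD1 i) //= tnth_mktuple iS expr0n -[_ == _]negbK -lt0n lt mul0r.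
rewrite negb_exists_in => /forall_inP h0; rewrite mpolyXE_id.
apply: eq_bigr => i _; rewrite tnth_mktuple; case: ifP => // /h0.
by rewrite -eqn0Ngt => /eqP ->; rewrite !expr0.
Qed.

Lemma mcoeff_kill S f m : (kill S f)@_m = if meets S m then 0 else f@_m.
Proof.
have E : kill S f = \sum_(k <- msupp f) f@_k *: kill S 'X_[k].
  exact: comp_mpolyEX.
rewrite E raddf_sum /= [in RHS](mpolyE f) [X in if _ then _ else X]raddf_sum /=.
case: ifP => mS; [rewrite big1 // => k _|apply: eq_bigr => k _];
  rewrite !mcoeffZ killX.
  case: ifP => kS; first by rewrite mcoeff0 mulr0.
  rewrite mcoeffX; case: eqP => [E'|]; last by rewrite mulr0.
  by rewrite E' mS in kS.
case: ifP => kS //; rewrite mcoeff0 mcoeffX; case: eqP => [E'|] //.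
by rewrite -E' kS in mS.
Qed.

Lemma prime_of_kill S f : prime_of S f <-> kill S f = 0.
Proof.
split=> [Sf|k0 m].
  apply/mpolyP => m; rewrite mcoeff_kill mcoeff0; case: ifPn => // nS.
  by apply/eqP; rewrite mcoeff_eq0; apply: contra nS => /Sf.
rewrite mcoeff_msupp; apply: contraR => /negPf nS.
by apply/eqP; move: k0 => /(congr1 (mcoeff m)); rewrite mcoeff_kill nS mcoeff0.
Qed.

Lemma prime_of_mul S f g : prime_of S (f * g) -> prime_of S f \/ prime_of S g.
Proof.
move/prime_of_kill; rewrite /kill rmorphM => /eqP; rewrite mulf_eq0.
by case/orP=> /eqP k0; [left|right]; apply/prime_of_kill.
Qed.

Lemma prime_of_ideal S : is_ideal (prime_of S).
Proof. exact: mideal_is_ideal (@meets_upset S). Qed.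

Lemma prime_of_prime S : is_prime_ideal (prime_of S).
Proof.
split; first exact: prime_of_ideal.
split; last by move=> f g; apply: prime_of_mul.
move/(_ 0%MM); rewrite msupp1 mem_seq1 eqxx => /(_ isT) /exists_inP[i _].
by rewrite mnm0E.
Qed.

(* Peeling one variable x_t off p exhibits R/(x_S, x^p) as an extension of
   R/(x_S, x^(p - e_t)) by R/(x_S, x_t). *)
Lemma wreg_add_monomial S (p : 'X_{1..n}) (fs : seq {mpoly K[n]}) :
  (forall i, i \in S -> p i = 0%N) ->
  (forall t, t \notin S -> wreg (prime_of (t |: S)) fs) ->
  wreg (mideal (fun m => meets S m || (p <= m)%MM)) fs.
Proof.
move=> + reg; have [d] := ubnP (mdeg p); elim: d p => // d IH p le p0.
have [->|/eqP p_neq0] := eqVneq p 0%MM.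
  by apply: wreg_full => h m _; apply/orP; right; apply/mnm_lepP=> i; rewrite mnm0E.
have [t pt] : exists t, (0 < p t)%N.
  apply/existsP; rewrite -[[exists _, _]]negbK negb_exists; apply/negP=> /forallP h0.
  by apply: p_neq0; apply/mnmP=> i; rewrite mnm0E; apply/eqP; rewrite eqn0Ngt; exact: h0.
have tS : t \notin S by apply/negP=> /p0 E; rewrite E in pt.
have Ut : (U_(t) <= p)%MM.
  by apply/mnm_lepP=> i; rewrite mnm1E; case: eqP => // <-.
pose q := (p - U_(t))%MM; have Ep : p = (U_(t) + q)%MM by rewrite addmC submK.
have q0 i : i \in S -> q i = 0%N by move=> iS; rewrite mnmBE p0.
have up : upset (fun m => meets S m || (p <= m)%MM).
  move=> a b /orP[/(meets_upset b) -> //|le2]; apply/orP; right.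
  by apply: lepm_trans le2 (lem_addr _ _).
apply: (@wreg_extension _ _ _ 'X_[q]); first exact: mideal_is_ideal.
  apply: wreg_ext (reg _ tS) => h; split=> [hm|/colon_mideal hm]; last first.
    move=> m /hm; rewrite Ep => /orP[/exists_inP[i iS]|/mnm_lepP le2].
      rewrite mnmDE q0 // => lt; apply/exists_inP; exists i => //.
      by rewrite in_setU1 iS orbT.
    apply/exists_inP; exists t; rewrite ?setU11 //.
    by have := le2 t; rewrite !mnmDE mnm1E eqxx addnC leq_add2l.
  apply/colon_mideal => m /hm /exists_inP[i]; rewrite in_setU1 => /orP[/eqP ->|iS] lt.
    apply/orP; right; rewrite Ep addmC; apply/mnm_lepP=> j.
    by rewrite !mnmDE leq_add2l mnm1E; case: eqP => // <-.
  apply/orP; left; apply/exists_inP; exists i => //.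
  by rewrite mnmDE addn_gt0 lt orbT.
have : wreg (mideal (fun m => meets S m || (q <= m)%MM)) fs.
  by apply: IH => //; move: le; rewrite Ep mdegD mdeg1; lia.
apply: wreg_ext => h; rewrite addI_mideal //; apply: mideal_ext => m.
rewrite -orbA; congr (_ || _); apply/idP/orP; first by right.
by case=> // le2; apply: lepm_trans le2; apply: lem_subr.
Qed.

(** Degrees descend, so that each head is a single monomial modulo the variables killed so far. *)
Fixpoint mesyms (r : nat) : seq {mpoly K[n]} :=
  if r is r'.+1 then mesym n K r :: mesyms r' else [::].

Lemma size_mesyms r : size (mesyms r) = r.
Proof. by elim: r => //= r ->. Qed.

(* On R/(x_S) with r variables left, e_r is the product of these variables,
   so R/(x_S, e_r) is filtered by the R/(x_S, x_t). *)
Lemma wreg_mesyms r S : (#|S| + r = n)%N -> wreg (prime_of S) (mesyms r).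
Proof.
elim: r S => //= r IH S cS.
have cC : #|~: S| = r.+1.
  by have := cardsC S; rewrite card_ord -[in RHS]cS => /addnI.
(* Modulo x_S, every squarefree monomial of degree r + 1 vanishes except the product of the
   variables outside [S]. *)
have Eh (h : {set 'I_n}) : #|h| = r.+1 -> meets S (mesym1 h) = (h != ~: S).
  move=> ch; apply/exists_inP/idP => [[i iS]|ne].
    rewrite mnmE; case: (boolP (i \in h)) => // ih _.
    by apply: contraL ih => /eqP ->; rewrite inE iS.
  suff /subsetPn[i ih] : ~~ (h \subset ~: S).
    by rewrite inE negbK => iS; exists i => //; rewrite mnmE ih.
  apply: contra ne => sub; by rewrite eqEcard sub /= ch cC.
have congr : prime_of S (mesym n K r.+1 - 'X_[mesym1 (~: S)]).
  rewrite mesymE (bigD1 (~: S)) /=; last by rewrite cC.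
  rewrite addrAC subrr add0r big_mkcond.
  apply: (ideal_sum (prime_of_ideal S)) => h _.
  case: ifP => [/andP[/eqP ch ne]|_]; last exact: ideal0 (prime_of_ideal S).
  by apply/midealX; rewrite Eh.
split.
  move=> g /prime_of_mul[//|es]; exfalso.
  have : prime_of S 'X_[mesym1 (~: S)].
    have -> : 'X_[mesym1 (~: S)] = mesym n K r.+1 - (mesym n K r.+1 - 'X_[mesym1 (~: S)]) by ring.
    exact: (idealB (prime_of_ideal S)).
  by move/midealX; rewrite Eh // eqxx.
have : wreg (mideal (fun m => meets S m || (mesym1 (~: S) <= m)%MM)) (mesyms r).
  apply: wreg_add_monomial => [i iS|t tS]; first by rewrite mnmE inE iS.
  by apply: IH; rewrite cardsU1 tS add1n addSnnS.
have hI := prime_of_ideal S.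
apply: wreg_ext => h; rewrite -addI_mideal; last exact: meets_upset.
by split; apply: addI_congr => //; rewrite -opprB; apply: (idealN hI).
Qed.

End MonomialIdeals.

(** * Algebraic dependence of n - 1 polynomials, by counting monomials *)

Section DimensionBound.
Variables (K : fieldType) (n : nat).
Implicit Types (f g : {mpoly K[n]}) (fs : seq {mpoly K[n]}).

Definition degle (d : nat) f := forall m, m \in msupp f -> (mdeg m <= d)%N.

Lemma degleM d e f g : degle d f -> degle e g -> degle (d + e) (f * g).
Proof.
move=> hf hg m /msuppM_le /allpairsP[[a b] /= [/hf la /hg lb ->]].
by rewrite mdegD leq_add.
Qed.

Lemma degle1 d : degle d 1.
Proof. by move=> m; rewrite msupp1 mem_seq1 => /eqP ->; rewrite mdeg0. Qed.

Lemma degleX d f k : degle d f -> degle (k * d) (f ^+ k).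
Proof.
move=> hf; elim: k => [|k IH]; first exact: degle1.
by rewrite exprS mulSn; apply: degleM.
Qed.

Lemma degle_fpow N D fs e :
  (forall f, f \in fs -> degle D f) -> (forall i, nth 0%N e i < N)%N ->
  degle (size fs * (N * D)) (fpow fs e).
Proof.
elim: fs e => [|f fs IH] e hfs he /=; first exact: degle1.
rewrite mulSn; apply: degleM.
  move=> m /(degleX (hfs f (mem_head _ _))) /leq_trans; apply.
  by rewrite leq_mul2r -nth0 ltnW ?orbT.
apply: IH => [g gin|i]; first by apply: hfs; rewrite inE gin orbT.
by rewrite nth_behead.
Qed.

Lemma card_ord_lt M W : (#|[pred v : 'I_M | (v < W)%N]| <= W)%N.
Proof.
rewrite cardE -(size_map val) -[X in (_ <= X)%N](size_iota 0).
apply: uniq_leq_size; first by rewrite (map_inj_uniq val_inj) enum_uniq.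
by move=> x /mapP[v]; rewrite mem_enum => lt ->; rewrite mem_iota.
Qed.

(** One coordinate has at most [W] values and another only one, so just n - 2 coordinates range
    freely over [M] values. *)
Lemma card_bounded_ffun (M W : nat) (i j : 'I_n) : i != j ->
  (#|[set e : {ffun 'I_n -> 'I_M} | (e i < W) && (e j == 0%N :> nat)]|
     <= W * M ^ (n - 2))%N.
Proof.
move=> ij.
pose F (k : 'I_n) : pred 'I_M :=
  if k == i then [pred v : 'I_M | (v < W)%N] else if k == j then [pred v : 'I_M | (v < 1)%N]
  else predT.
have -> : #|[set e : {ffun 'I_n -> 'I_M} | (e i < W)%N && (e j == 0%N :> nat)]|
  = #|family F|.
  rewrite cardsE; apply: eq_card => e; rewrite !inE.
  apply/andP/forallP => [[lt e0] k|hF].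
    suff : F k (e k) by [].
    rewrite /F; case: (k =P i) => [->|_]; first exact: lt.
    by case: (k =P j) => [->|_] //=; rewrite ltnS leqn0.
  have Fi : F i (e i) := hF i; have Fj : F j (e j) := hF j.
  move: Fi Fj; rewrite /F eqxx eq_sym (negPf ij) eqxx /= ltnS leqn0.
  by split.
rewrite card_family foldrE big_image /= (bigD1 i) //= (bigD1 j) //=; last by rewrite eq_sym.
rewrite {1}/F eqxx leq_mul ?card_ord_lt //.
rewrite {1}/F eq_sym (negPf ij) eqxx -[X in (_ <= X)%N]mul1n leq_mul ?card_ord_lt //.
rewrite (eq_bigr (fun=> M)) => [|k /andP[ki kj]]; last first.
  by rewrite /F (negPf ki) (negPf kj) cardT size_enum_ord.
rewrite prod_nat_const.
have -> : (n - 2)%N = #|[pred k | (k != i) && (k != j)]|.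
  have := cardC (pred2 i j); rewrite card2 ij card_ord => En.
  rewrite -[X in (X - _)%N]En addKn; apply: eq_card => k.
  by rewrite !inE negb_or.
by [].
Qed.

Definition mon_of M (e : {ffun 'I_n -> 'I_M}) : 'X_{1..n} := [multinom (e i : nat) | i < n].

(* The products f^e with exponents below N number N^(n-1), and their supports
   modulo the ideal lie in a set of monomials of size O(N^(n-2)). *)
Lemma chain_size_bound (U : pred 'X_{1..n}) (W : nat) (L : ideal_of K n) fs :
  is_ideal L -> (forall h, mideal U h -> L h) -> (1 < n)%N -> size fs = n.-1 ->
  (forall m, ~~ U m -> exists i j, [/\ i != j, (m i < W)%N & m j = 0%N]) ->
  ~ chain L fs.
Proof.
move=> hL UL n2 sz hU ch.
pose D := \max_(f <- fs) msize f.
have hD f : f \in fs -> degle D f.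
  move=> fin m /msize_mdeg_lt lt; apply: leq_trans (ltnW lt) _.
  exact: (leq_bigmax_seq (F := fun f => msize f)) fin _.
(* The factor n * n bounds the number of pairs (i, j). [M] exceeds the degree r * N * D allowed to
   the products, and [N] is large enough that N^(n-1) exceeds n * n * W * M^(n-2). *)
pose r := n.-1; pose N := (n * n * W * (r * D + 1) ^ (n - 2)).+1.
pose M := (N * (r * D + 1))%N.
pose bad : {set {ffun 'I_n -> 'I_M}} := \bigcup_(p | p.1 != p.2)
  [set e : {ffun 'I_n -> 'I_M} | (e p.1 < W)%N && (e p.2 == 0%N :> nat)].
have bad_le : (#|bad| <= n * n * (W * M ^ (n - 2)))%N.
  have -> : (n * n * (W * M ^ (n - 2)) = \sum_(p : 'I_n * 'I_n) W * M ^ (n - 2))%N.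
    by rewrite sum_nat_const card_prod card_ord.
  rewrite [leqRHS](bigID (fun p => p.1 != p.2)) /=; apply: leq_trans (leq_addr _ _).
  apply: (big_ind2 (fun (A : {set {ffun 'I_n -> 'I_M}}) k => (#|A| <= k)%N)).
  - by rewrite cards0.
  - by move=> A a B b lA lB; apply: leq_trans (leq_card_setU _ _) (leq_add lA lB).
  - by move=> p; apply: card_bounded_ffun.
set E := exps N (size fs).
have bad_lt : (#|bad| < size E)%N.
  apply: leq_ltn_trans bad_le _; rewrite size_exps sz.
  have -> : n.-1 = (n - 2).+1 by lia.
  by rewrite /M expnMn [(N ^ _ * _)%N]mulnC !mulnA expnS ltn_pmul2r ?expn_gt0 //.
(* There are more products than bad monomials, so a nonzero vector of the left kernel combines the
   products with every bad coefficient zero. *)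
pose A := \matrix_(a < size E, b < #|bad|)
  (fpow fs (nth [::] E a))@_(mon_of (enum_val b)).
have /rowV0Pn[u /sub_kermxP uA /eqP u0] : kermx A != 0.
  rewrite kermx_eq0 -row_leq_rank -ltnNge.
  exact: leq_ltn_trans (rank_leq_col A) bad_lt.
pose c e := if insub (index e E) is Some k then u 0 k else 0.
have cE (k : 'I_(size E)) : c (nth [::] E k) = u 0 k.
  by rewrite /c index_uniq ?uniq_exps // valK.
case: u0; apply/rowP => k; rewrite mxE -cE.
apply: (chain_independent hL ch); last exact: mem_nth.
(* A monomial of the combination outside [U] would be bad, since the degree bound keeps its
   exponents below [M]; but its coefficient is then zero. *)
apply: UL; rewrite -/E (big_nth [::]) big_mkord => m mS; apply: contraT => /hU [i [j [ij lti ej]]].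
have mM l : (m l < M)%N.
  have : (mdeg m <= r * (N * D))%N.
    have [k' _ /msuppZ_le mk] : exists2 k' : 'I_(size E), true &
        m \in msupp (c (nth [::] E k') *: fpow fs (nth [::] E k')).
      move/msupp_sum_le: mS => /flattenP[_ /mapP[k' _ ->] mk].
      by exists k'.
    rewrite -[r]sz; apply: (degle_fpow hD) mk => l'.
    by apply: exps_lt => //; apply: mem_nth.
  have : (m l <= mdeg m)%N by rewrite mdegE (bigD1 l) //= leq_addr.
  move=> le1 le2; apply: leq_ltn_trans (leq_trans le1 le2) _.
  by rewrite /M mulnDr mulnCA; lia.
pose e := [ffun l => Ordinal (mM l)].
have eb : e \in bad.
  by apply/bigcupP; exists (i, j) => //; rewrite inE !ffunE /= lti ej.
have em : mon_of e = m by apply/mnmP => l; rewrite mnmE ffunE.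
move: mS; rewrite mcoeff_msupp => /eqP [].
have := congr1 (fun X : 'rV_#|bad| => X 0 (enum_rank_in eb e)) uA.
rewrite /= !mxE => E0; rewrite raddf_sum /= -[RHS]E0; apply: eq_bigr => k' _.
by rewrite mcoeffZ cE mxE enum_rankK_in // em.
Qed.

End DimensionBound.

(** * The cover ideal, built along the elimination ordering *)

Section CoverIdeal.
Variables (K : fieldType) (n : nat) (G D : rel 'I_n) (w : 'I_n -> nat) (s : seq 'I_n).
Hypothesis wo : weighted_oriented G D w.
Hypothesis peo : perfect_elimination_ordering (compl_graph G) s.
Hypothesis star : property_star G D w s.
Implicit Types m : 'X_{1..n}.

Lemma edge_asym i j : D i j -> ~~ D j i.
Proof.
by case: wo => _ [[DG xorD] _] Dij; move: (xorD _ _ (DG _ _ Dij)); rewrite Dij andbF orbF.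
Qed.

Lemma edge_neq i j : D i j -> i != j.
Proof.
move=> Dij; apply/eqP=> E; move: (edge_asym Dij).
by rewrite E in Dij *; rewrite Dij.
Qed.

Lemma edge_tail_not_sink i j : D i j -> ~ is_sink G D i.
Proof.
case: wo => [[_ sym] [[DG _] _]] Dij /(_ j); rewrite sym => /(_ (DG _ _ Dij)).
by apply/negP; apply: edge_asym.
Qed.

(* The ideal of the first k vertices in the ordering, after splitting off from
   each vertex p of weight > 1 one clone of p of weight w p - 1 that precedes
   every vertex: for k = n it is the intersection of all <x_p^(w p), x_j>. *)
Definition level (k : nat) : pred 'X_{1..n} := fun m =>
  [forall p, forall j, D p j && (index j s < k)%N ==>
     (0 < m j)%N || ((if (index p s < k)%N then w p else (w p).-1) <= m p)%N].

Lemma levelP k m : reflect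
  (forall p j, D p j -> (index j s < k)%N ->
     (0 < m j)%N || ((if (index p s < k)%N then w p else (w p).-1) <= m p)%N)
  (level k m).
Proof.
apply: (iffP forallP) => [h p j Dpj lt|h p].
  by move: (h p) => /forallP/(_ j)/implyP; apply; rewrite Dpj.
by apply/forallP => j; apply/implyP => /andP[]; apply: h.
Qed.

Lemma level_upset k : upset (level k).
Proof.
move=> a b /levelP h; apply/levelP => p j Dpj /(h p j Dpj) /orP[lt|le].
  by rewrite mnmDE addn_gt0 lt.
by rewrite !mnmDE (leq_trans le) ?leq_addr ?orbT.
Qed.

Section Step.
Variables (k : nat) (v : 'I_n).
Hypothesis idx_v : index v s = k.
Hypothesis idx_lt : forall i, (index i s < k.+1)%N = (i == v) || (index i s < k)%N.

(** What the edges at [v] demand of a monomial free of x_v: exponent 1 at earlier out-neighbours,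
    and at in-neighbours the weight, or only that of the clone if they come later. *)
Definition nbr_exp : 'X_{1..n} := [multinom
  if i == v then 0%N
  else if D v i && (index i s < k)%N then 1%N
  else if D i v then (if (index i s < k)%N then w i else (w i).-1) else 0%N | i < n].

(** A factor x_v settles all edges into [v] and lowers by one the power of x_v asked by edges out of
    [v], which leaves exactly the clone of [v]. *)
Lemma level_colon m : level k.+1 (U_(v) + m)%MM = level k m.
Proof.
have vk : (index v s < k)%N = false by rewrite idx_v ltnn.
apply/levelP/levelP => h p j Dpj jk.
  have jv : (v == j) = false by apply/eqP=> E; rewrite -E vk in jk.
  have := h p j Dpj; rewrite idx_lt jk orbT idx_lt !mnmDE !mnm1E jv => /(_ isT).
  case: (eqVneq v p) => [<-|pv] /=; last by rewrite add0n.
  by rewrite vk add0n; case/orP=> [->//|le]; apply/orP; right; lia.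
rewrite !idx_lt !mnmDE !mnm1E.
move: jk; rewrite idx_lt; have [->|jv /= jk] := eqVneq j v; first by rewrite ?eqxx.
have := h p j Dpj jk; rewrite add0n.
by have [->|pv] := eqVneq p v; rewrite /= ?vk ?eqxx ?add0n //; lia.
Qed.

(* The neighbours of v already force every earlier edge (p, j): if j is not
   adjacent to v then property (star), or for w p = 1 the elimination ordering,
   provides p as an in-neighbour. *)
Lemma level_add m :
  level k.+1 m || (U_(v) <= m)%MM = meets [set v] m || (nbr_exp <= m)%MM.
Proof.
have vk : (index v s < k)%N = false by rewrite idx_v ltnn.
have -> : (U_(v) <= m)%MM = (0 < m v)%N.
  apply/mnm_lepP/idP => [/(_ v)|lt i]; first by rewrite mnm1E eqxx.
  by rewrite mnm1E; case: eqP => // <-.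
have -> : meets [set v] m = (0 < m v)%N.
  by apply/exists_inP/idP => [[i /set1P -> //]|]; exists v => //; rewrite set11.
have [m0|m0] := posnP (m v); last by rewrite !orbT.
rewrite orbF /=; apply/levelP/mnm_lepP => [h i|h p j Dpj].
  rewrite mnmE; case: eqVneq => // iv; case: ifP => [/andP[Dvi ik]|nD].
    have := h v i Dvi; rewrite !idx_lt ik eqxx orbT m0 => /(_ isT) /orP[//|].
    by case: wo => _ [_ [w0 _]]; rewrite leqNgt w0.
  case: ifP => // Div; have := h i v Div.
  by rewrite !idx_lt eqxx m0 (negPf iv) => /(_ isT).
rewrite !idx_lt; have [Ej _|jv /= jk] := eqVneq j v.
  subst j; have pv := negPf (edge_neq Dpj).
  have := h p; rewrite mnmE pv (negPf (edge_asym Dpj)) Dpj /= => ->.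
  by rewrite orbT.
have [wsym [[DG xorD] [w0 _]]] := wo; have sym := wsym.2.
have [Dvj|nDvj] := boolP (D v j).
  by have := h j; rewrite mnmE (negPf jv) Dvj jk /= => ->.
have [Djv|nDjv] := boolP (D j v).
  by have := h j; rewrite mnmE (negPf jv) (negPf nDvj) Djv jk /= => /(leq_trans (w0 j)) ->.
have nG : ~~ G j v by apply/negP=> /xorD; rewrite (negPf nDvj) (negPf nDjv).
have pv : (p == v) = false.
  by apply/eqP=> E; rewrite -E in nDvj; rewrite Dpj in nDvj.
rewrite pv /=; apply/orP; right; have := h p; rewrite mnmE pv.
have [w1|w1] := eqVneq (w p) 1%N; last first.
  have Dpv : D p v.
    apply: contraT => /(star _ jv nG (edge_tail_not_sink Dpj) (elimN eqP w1)).
    by rewrite idx_v Dpj => /(_ jk).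
  by rewrite (negPf (edge_asym Dpv)) Dpv.
case: ifP => [/andP[_ ->]|nvp]; first by rewrite w1.
(* If [p] comes later, only its clone counts, and that has weight 0. *)
have [pk|] := boolP (index p s < k)%N; last by rewrite w1.
(* Now [p] and [j] are both earlier than [v] and not adjacent to it in [G], so the elimination
   ordering makes them nonadjacent in [G], against [D p j]. *)
case: ifP => // nDpv _; exfalso.
have nGp : ~~ G p v.
  by apply/negP=> /xorD; move: nvp; rewrite pk andbT nDpv => ->.
have := peo.2 v p j; rewrite idx_v /compl_graph pv nGp jv nG => /(_ pk jk isT isT (edge_neq Dpj)).
by rewrite (DG _ _ Dpj) andbF.
Qed.

End Step.

(** At k = 0 the quotient is zero. Each vertex [v] contributes R/(x_v, x^[nbr_exp]), and peeling
    that monomial involves only quotients R/(x_v, x_t), whence sets of size 2. *)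
Lemma wreg_level (fs : seq {mpoly K[n]}) k : (k <= n)%N ->
  (forall S : {set 'I_n}, #|S| = 2 -> wreg (prime_of S) fs) ->
  wreg (mideal (level k)) fs.
Proof.
move=> + reg; elim: k => [_|k IH kn].
  by apply: wreg_full => h m _; apply/levelP.
have szs : size s = n by rewrite (perm_size peo.1) size_enum_ord.
have us : uniq s by rewrite (perm_uniq peo.1) enum_uniq.
pose v := nth (Ordinal kn) s k.
have idx_v : index v s = k by rewrite index_uniq ?szs.
have idx_lt i : (index i s < k.+1)%N = (i == v) || (index i s < k)%N.
  rewrite ltnS leq_eqVlt; congr (_ || _); apply/eqP/eqP => [E|-> //].
  by rewrite -[i](@nth_index _ (Ordinal kn) _ s) ?E // (perm_mem peo.1) mem_enum.
apply: (@wreg_extension _ _ _ 'X_[U_(v)]).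
- exact/mideal_is_ideal/level_upset.
- apply: wreg_ext (IH (ltnW kn)) => h; rewrite colon_mideal.
  by apply: mideal_ext => m; rewrite (level_colon idx_v idx_lt).
- have : wreg (mideal (fun m => meets [set v] m || (nbr_exp k v <= m)%MM)) fs.
    apply: wreg_add_monomial => [i /set1P ->|t tv]; first by rewrite mnmE eqxx.
    by apply: reg; rewrite cardsU1 tv cards1.
  apply: wreg_ext => h; rewrite addI_mideal; last exact: level_upset.
  by apply: mideal_ext => m; rewrite (level_add idx_v idx_lt).
Qed.

End CoverIdeal.

(** * The Alexander dual is the ideal of weighted covers *)

Section AlexanderDual.
Variables (K : fieldType) (n : nat) (G D : rel 'I_n) (w : 'I_n -> nat).
Variable (B : seq {ffun 'I_n -> nat}).
Hypothesis wo : weighted_oriented G D w.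
Hypothesis dec : forall f, edge_ideal D w f <-> (forall b, b \in B -> @mpow K n b f).
Implicit Types (m : 'X_{1..n}) (b e : {ffun 'I_n -> nat}).

Definition mnm_of_ffun e : 'X_{1..n} := [multinom e i | i < n].

Lemma monomE e : monom K e = 'X_[mnm_of_ffun e].
Proof. by rewrite mpolyXE_id; apply: eq_bigr => i _; rewrite mnmE. Qed.

Definition edge_exp (i j : 'I_n) : {ffun 'I_n -> nat} :=
  [ffun k => ((k == i) + (k == j) * w j)%N].

Lemma edge_expE i j k : edge_exp i j k = ((k == i) + (k == j) * w j)%N.
Proof. by rewrite ffunE. Qed.

Lemma dual_expE (a b : {ffun 'I_n -> nat}) i :
  dual_exp a b i = if (0 < b i)%N then (a i + 1 - b i)%N else 0%N.
Proof. by rewrite ffunE. Qed.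

Lemma edge_expsP e :
  reflect (exists i j, D i j /\ e = edge_exp i j) (e \in edge_exps D w).
Proof.
apply: (iffP mapP) => [[[i j]]|[i [j [Dij ->]]]].
  by rewrite mem_filter => /andP[Dij _] ->; exists i, j.
exists (i, j) => //; rewrite mem_filter Dij /=.
by apply/allpairsP; exists (i, j); rewrite !mem_enum.
Qed.

(** A generator dividing this one has both its variables among x_i and x_j, and the orientation
    excludes the reversed edge. *)
Lemma edge_exp_minimal i j : D i j -> edge_exp i j \in minimal_exps (edge_exps D w).
Proof.
have [_ [_ [w0 _]]] := wo.
move=> Dij; rewrite mem_filter andbC; apply/andP; split.
  by apply/edge_expsP; exists i, j.
apply/hasPn => f /edge_expsP[p [q [Dpq ->]]]; rewrite negb_and negbK.
rewrite -implybE; apply/implyP=> /forallP le.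
have sub k : k \in [:: p; q] -> k \in [:: i; j].
  move=> kpq; have := le k; rewrite !ffunE !inE in kpq *; have := w0 q.
  by case/orP: kpq => /eqP ->; rewrite eqxx; do 2?[case: (_ =P i)]; case: (_ =P j); lia.
have := sub p; have := sub q; rewrite !inE !eqxx !orbT /= => /(_ isT) hq /(_ isT) hp.
have pq := edge_neq wo Dpq; have asym := edge_asym wo Dij.
suff [-> ->] : p = i /\ q = j by apply/forallP.
case/orP: hp => /eqP Ep; case/orP: hq => /eqP Eq //; subst p q.
- by rewrite eqxx in pq.
- by rewrite Dpq in asym.
- by rewrite eqxx in pq.
Qed.

Let a := lcm_exp (edge_exps D w).

Lemma lcm_exp_le i : (a i <= w i)%N.
Proof.
have [_ [_ [w0 _]]] := wo.
rewrite ffunE; apply/bigmax_leqP_seq => e; rewrite mem_filter => /andP[_].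
case/edge_expsP=> p [q [/(edge_neq wo) pq ->]] _; rewrite ffunE.
have := w0 i; case: (i =P p) => [E|_]; case: (i =P q) => [E'|_]; try subst; try lia.
by rewrite eqxx in pq.
Qed.

Lemma lcm_exp_head i j : D i j -> a j = w j.
Proof.
move=> Dij; apply/eqP; rewrite eqn_leq lcm_exp_le /= /a ffunE.
apply: leq_trans (@leq_bigmax_seq _ _ xpredT (fun e : {ffun 'I_n -> nat} => e j) _
    (edge_exp_minimal Dij) isT).
by rewrite ffunE eqxx mul1n leq_addl.
Qed.

(** Either [i] is a source, of weight 1 by convention, or it is the head of some edge. *)
Lemma lcm_exp_tail i j : D i j -> a i = w i.
Proof.
move=> Dij; have [[_ sym] [[DG xorD] [w0 src]]] := wo.
have [/forallP h|] := boolP [forall k, G i k ==> D i k].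
  have w1 : w i = 1%N by apply: src => k; apply/implyP; exact: h.
  apply/eqP; rewrite eqn_leq lcm_exp_le w1 /= /a ffunE.
  apply: leq_trans (@leq_bigmax_seq _ _ xpredT (fun e : {ffun 'I_n -> nat} => e i) _
    (edge_exp_minimal Dij) isT).
  by rewrite ffunE eqxx.
rewrite negb_forall => /existsP[k]; rewrite negb_imply => /andP[Gik /negPf nD].
by move: (xorD _ _ Gik); rewrite nD andbT /= => /lcm_exp_head.
Qed.

Definition in_mpow b : pred 'X_{1..n} := fun m => [exists t, (0 < b t <= m t)%N].

Lemma in_mpow_upset b : upset (in_mpow b).
Proof.
move=> m m' /existsP[t /andP[b0 le]]; apply/existsP; exists t.
by rewrite b0 mnmDE (leq_trans le) ?leq_addr.
Qed.

Lemma var_pow i k : 'X_i ^+ k = 'X_[(U_(i) *+ k)%MM] :> {mpoly K[n]}.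
Proof. by rewrite mpolyXn. Qed.

Lemma mpowX b m : mpow b ('X_[m] : {mpoly K[n]}) <-> in_mpow b m.
Proof.
split.
  move=> h; apply/(midealX K); apply: gen_idealP h.
    exact/mideal_is_ideal/in_mpow_upset.
  move=> g /mapP[i]; rewrite mem_filter => /andP[b0 _] ->.
  rewrite var_pow; apply/midealX/existsP; exists i.
  by rewrite b0 mulmnE mnm1E eqxx mul1n leqnn.
case/existsP=> t /andP[b0 le]; rewrite -(@submK _ (U_(t) *+ b t) m).
  rewrite mpolyXD -var_pow /mpow; apply: (idealMleft _ (gen_ideal_is_ideal _)).
  by apply: mem_gen_ideal; apply/mapP; exists t; rewrite // mem_filter b0 mem_enum.
by apply/mnm_lepP=> i; rewrite mulmnE mnm1E; case: eqP => [<-|] //; rewrite mul1n.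
Qed.

Definition weighted_cover : pred 'X_{1..n} := fun m =>
  [forall p, forall j, D p j ==> (0 < m j)%N || (w p <= m p)%N].

Lemma weighted_coverP m :
  reflect (forall p j, D p j -> (0 < m j)%N || (w p <= m p)%N) (weighted_cover m).
Proof.
apply: (iffP forallP) => [h p j|h p]; first by move: (h p) => /forallP/(_ j)/implyP.
by apply/forallP => j; apply/implyP; apply: h.
Qed.

Lemma weighted_cover_upset : upset weighted_cover.
Proof.
move=> m m' /weighted_coverP h; apply/weighted_coverP => p j /h /orP[lt|le].
  by rewrite mnmDE addn_gt0 lt.
by rewrite !mnmDE (leq_trans le) ?leq_addr ?orbT.
Qed.

(** The generator of the edge lies in m^b: either b_p = 1, and the dual exponent at p is w p, or 1
    <= b_j <= w j, and the one at j is positive. *)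
Lemma dual_exp_weighted_cover b : b \in B -> weighted_cover (mnm_of_ffun (dual_exp a b)).
Proof.
move=> bB; apply/weighted_coverP => p j Dpj; rewrite !mnmE !dual_expE.
have : edge_ideal D w (monom K (edge_exp p j)).
  apply: mem_gen_ideal; apply: map_f; apply/edge_expsP.
  by exists p, j.
move/dec/(_ b bB); rewrite monomE => /mpowX /existsP[t].
have pj := negPf (edge_neq wo Dpj).
rewrite mnmE edge_expE (lcm_exp_head Dpj) (lcm_exp_tail Dpj) => /andP[b0].
have [E|tp] := eqVneq t p.
  by subst t; rewrite pj b0 => le; apply/orP; right; lia.
have [E|tj] := eqVneq t j; last by rewrite leqNgt b0.
by subst t; rewrite b0 => le; apply/orP; left; lia.
Qed.

(* The irreducible ideal m^c attached to m contains I, hence, being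
   irreducible, some component m^b; this b yields the generator dividing x^m. *)
Lemma weighted_cover_dual_exp m : weighted_cover m ->
  exists2 b, b \in B & (mnm_of_ffun (dual_exp a b) <= m)%MM.
Proof.
move=> /weighted_coverP cm; have [_ [_ [w0 _]]] := wo.
(* Truncating [m] at [a] keeps [c i] positive wherever x_i divides x^m. *)
pose c : {ffun 'I_n -> nat} :=
  [ffun i => if (0 < m i)%N then (a i + 1 - minn (m i) (a i))%N else 0%N].
have cE i : c i = if (0 < m i)%N then (a i + 1 - minn (m i) (a i))%N else 0%N.
  by rewrite ffunE.
have sub f : edge_ideal D w f -> mideal (in_mpow c) (f : {mpoly K[n]}).
  apply: gen_idealP; first exact/mideal_is_ideal/in_mpow_upset.
  move=> g /mapP[e /edge_expsP[p [j [Dpj ->]]] ->]; rewrite monomE.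
  apply/midealX/existsP; have pj := negPf (edge_neq wo Dpj).
  case/orP: (cm p j Dpj) => h; [exists j|exists p]; rewrite mnmE cE edge_expE.
    by rewrite h eqxx eq_sym pj (lcm_exp_head Dpj); have := w0 j; lia.
  have -> : (0 < m p)%N by apply: leq_trans (w0 p) h.
  by rewrite eqxx pj (lcm_exp_tail Dpj); have := w0 p; lia.
have [/hasP[b bB /forallP h]|nh] :=
    boolP (has (fun b => [forall t, (0 < b t)%N ==> (0 < c t <= b t)%N]) B).
  exists b => //; apply/mnm_lepP=> i; rewrite mnmE dual_expE; case: ifP => // b0.
  move/implyP: (h i) => /(_ b0); rewrite cE; case: ifP => // m0; lia.
exfalso.
(* Otherwise each m^b has a generator x_t^(b t) outside m^c. The lcm x^l of all these lies in every
   m^b, hence in m^c, yet [l t < c t] wherever [c t] is positive. *)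
pose bad b t := (0 < b t)%N && ~~ (0 < c t <= b t)%N.
pose l : 'X_{1..n} := [multinom \max_(b <- B | bad b i) b i | i < n].
have : in_mpow c l.
  apply/(midealX K)/sub/dec => b bB; apply/mpowX/existsP.
  move/hasPn: nh => /(_ b bB); rewrite negb_forall => /existsP[t].
  rewrite negb_imply => bt; exists t; case/andP: (bt) => -> _ /=.
  by rewrite mnmE; apply: (leq_bigmax_seq (F := fun b => b t)).
case/existsP=> t /andP[c0]; rewrite mnmE leqNgt => /negP; apply.
rewrite -[X in (_ < X)%N](prednK c0) ltnS; apply/bigmax_leqP_seq => b _ /andP[_].
by rewrite c0 /= -ltnNge; lia.
Qed.

Lemma alexander_dualE f : alexander_dual a B f <-> mideal weighted_cover (f : {mpoly K[n]}).
Proof.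
split.
  apply: gen_idealP; first exact/mideal_is_ideal/weighted_cover_upset.
  by move=> g /mapP[b bB ->]; rewrite monomE; apply/midealX/dual_exp_weighted_cover.
move=> hf; have gI := gen_ideal_is_ideal [seq monom K (dual_exp a b) | b <- B].
rewrite [f]mpolyE; apply: (ideal_sum gI) => m /hf /weighted_cover_dual_exp[b bB le].
apply: (idealZ _ gI); rewrite -(submK le) mpolyXD -monomE.
by apply: (idealMleft _ gI); apply: mem_gen_ideal; apply: map_f.
Qed.

End AlexanderDual.

(** * Chains of primes *)

Section PrimeChains.
Variables (K : fieldType) (n : nat).

(** Choose f_i in P_(i+1) outside P_i; it is a nonzerodivisor modulo P_i because P_i is prime. *)
Lemma prime_chain_separated d (P : nat -> ideal_of K n) :
  (forall i, (i <= d)%N -> is_prime_ideal (P i)) ->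
  (forall i, (i < d)%N -> (forall f, P i f -> P i.+1 f) /\ exists f, P i.+1 f /\ ~ P i f) ->
  exists2 fs, size fs = d & chain (P 0%N) fs.
Proof.
elim: d P => [|d IH] P hP hS.
  by exists [::] => //; have [_ []] := hP 0%N isT.
have [fs sz ch] := IH (fun i => P i.+1) (fun i => hP i.+1) (fun i => hS i.+1).
have [sub [f [f1 f0]]] := hS 0%N isT.
exists (f :: fs); first by rewrite /= sz.
have [_ [_ mul]] := hP 0%N isT.
split; first by move=> g /mul[].
by exists (P 1%N); split=> //; have [] := hP 1%N isT.
Qed.

Lemma prime_of_setT_max (f : {mpoly K[n]}) : prime_of setT f -> max_ideal f.
Proof.
move=> hf; have mI := gen_ideal_is_ideal [seq 'X_i : {mpoly K[n]} | i <- enum 'I_n].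
rewrite /max_ideal [f]mpolyE; apply: (ideal_sum mI) => m /hf /exists_inP[i _ mi].
have le : (U_(i) <= m)%MM.
  by apply/mnm_lepP=> j; rewrite mnm1E; case: eqP => // <-.
apply: (idealZ _ mI); rewrite -(submK le) mpolyXD; apply: (idealMleft _ mI).
by apply: mem_gen_ideal; apply: map_f; rewrite mem_enum.
Qed.

Lemma mesyms_setT r (f : {mpoly K[n]}) : f \in mesyms K n r -> prime_of setT f.
Proof.
elim: r => //= r IH; rewrite inE => /orP[/eqP ->|/IH //] m.
rewrite msupp_mesymP => /existsP[h /andP[/eqP ch /eqP ->]].
have /card_gt0P[i ih] : (0 < #|h|)%N by rewrite ch.
by apply/exists_inP; exists i => //; rewrite mnmE ih.
Qed.

(** The primes are generated by the first 2, 3, ..., n variables in an enumeration starting with [p]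
    and [j]. *)
Lemma max_prime_chain (p j : 'I_n) : p != j ->
  exists P, prime_chain (@prime_of K n [set p; j]) (n - 2) P.
Proof.
move=> pj; pose l := [:: p, j & [seq x <- enum 'I_n | x \notin [:: p; j]]].
have ul : uniq l.
  by rewrite /l /= inE negb_or pj !mem_filter !inE !eqxx ?orbT /= filter_uniq ?enum_uniq.
have sl : size l = n.
  have /perm_size -> : perm_eq l (enum 'I_n); last by rewrite size_enum_ord.
  apply: uniq_perm => // [|x]; first exact: enum_uniq.
  by rewrite /l !inE mem_filter !mem_enum !inE; case: (x == p); case: (x == j).
pose S i := [set x in take i.+2 l].
have subS i k : (i <= k)%N -> forall f, @prime_of K n (S i) f -> prime_of (S k) f.
  move=> ik f hf m /hf /exists_inP[x]; rewrite inE => xi mx.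
  apply/exists_inP; exists x => //; rewrite inE; move: xi.
  by rewrite -[take i.+2 l](@take_takel _ _ k.+2) //; apply: mem_take.
exists (fun i => @prime_of K n (S i)); split=> i id.
  split; first exact: prime_of_prime.
  move=> f hf; apply: (subS 0%N) => // m /hf /exists_inP[x].
  by move=> xin mx; apply/exists_inP; exists x => //; move: xin; rewrite /S /= take0 !inE.
split; first by apply: subS.
have lt : (i.+2 < size l)%N by rewrite sl; lia.
exists 'X_(nth p l i.+2); split.
  apply/midealX/exists_inP; exists (nth p l i.+2); last by rewrite mnm1E eqxx.
  by rewrite inE (take_nth p) // mem_rcons inE eqxx.
move/midealX/exists_inP=> [x]; rewrite inE mnm1E lt0b => xin /eqP E.
move: ul; rewrite -(cat_take_drop i.+2 l) cat_uniq => /and3P[_ /hasPn /(_ x) + _].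
by rewrite xin (drop_nth p) // E mem_head => /(_ isT).
Qed.

End PrimeChains.

(** * Dimension and depth are both n - 2 *)

Theorem theorem5p6 (K : fieldType) (n : nat) (G D : rel 'I_n) (w : 'I_n -> nat)
    (s : seq 'I_n) (B : seq {ffun 'I_n -> nat}) :
  weighted_oriented G D w ->
  (exists i j, G i j) ->
  chordal (compl_graph G) ->
  perfect_elimination_ordering (compl_graph G) s ->
  property_star G D w s ->
  irredundant_irreducible_decomposition (@edge_ideal K n D w) B ->
  cohen_macaulay_quot
    (@alexander_dual K n (lcm_exp (edge_exps D w)) B).
Proof.
move=> wo [i [i' Gii']] _ peo star [_ [dec _]].
have [p [j Dpj]] : exists p j, D p j.
  have [_ [[_ xorD] _]] := wo.
  by case/orP: (xorD _ _ Gii') => /andP[Dij _]; [exists i, i'|exists i', i].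
have pj := edge_neq wo Dpj.
have n2 : (1 < n)%N.
  by have := ltn_ord p; have := ltn_ord j; move: pj; rewrite -val_eqE /=; lia.
have [_ [_ [w0 _]]] := wo.
set J := alexander_dual _ _.
have JE f : J f <-> mideal (weighted_cover D w) f := alexander_dualE wo dec f.
have JI : is_ideal J := gen_ideal_is_ideal _.
have Jp f : J f -> prime_of [set p; j] f.
  move=> /JE hf m /hf /weighted_coverP /(_ p j Dpj) /orP[lt|le]; apply/exists_inP.
    by exists j; rewrite // !inE eqxx orbT.
  by exists p; rewrite ?inE ?eqxx // (leq_trans (w0 p) le).
(* A monomial outside [J] violates some edge (a, b): its exponent at [b] is 0 and that at [a] is
   below [w a], hence below the maximal weight. *)
have bound L fs : is_ideal L -> (forall h, J h -> L h) -> size fs = n.-1 -> ~ chain L fs.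
  move=> hL JL sz; apply: (@chain_size_bound _ _ (weighted_cover D w) (\max_k w k)) => //.
    by move=> h /JE /JL.
  move=> m; rewrite negb_forall => /existsP[a]; rewrite negb_forall => /existsP[b].
  rewrite negb_imply negb_or => /and3P[Dab]; rewrite -leqNgt leqn0 => /eqP mb.
  rewrite -ltnNge => lt; exists a, b; split=> //; first exact: (edge_neq wo Dab).
  by apply: leq_trans lt (leq_bigmax a).
have En : (n - 2).+1 = n.-1 by lia.
exists (n - 2)%N; split; split.
- have [P [hP hS]] := @max_prime_chain K n p j pj.
  by exists P; split=> // k /hP[pP sub]; split=> // f /Jp /sub.
- case=> P [hP hS]; have [fs sz ch] := @prime_chain_separated _ _ _ P (fun k le => (hP k le).1) hS.
  have [[PI _] sub] := hP 0%N isT.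
  by apply: bound ch; rewrite ?sz.
- exists (mesyms K n (n - 2)); split; first exact: size_mesyms.
  split; first by move=> f /mesyms_setT /prime_of_setT_max.
  have TI := @prime_of_ideal K n setT.
  split; last first.
    (* Properness: [J] and all the e_i lie in the ideal of all variables. *)
    move=> [h [/Jp Jh h1]]; have [_ [n1 _]] := @prime_of_prime K n setT.
    apply: n1; rewrite -(subrK h 1); apply: (idealD TI).
      by apply: gen_idealP h1 => // f /mesyms_setT.
    by move=> m /Jh /exists_inP[x _ mx]; apply/exists_inP; exists x.
  apply/wregP => //.
  have : wreg (mideal (level D w s n)) (mesyms K n (n - 2)).
    apply: (wreg_level wo peo star) => // S cS; apply: wreg_mesyms.
    by rewrite cS subnKC.
  apply: wreg_ext => h; rewrite JE; apply: mideal_ext => m.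
  (* All positions are below n, so [level] n asks the full weight at every vertex. *)
  have lt k : (index k s < n)%N.
    have := perm_mem peo.1 k; rewrite mem_enum -index_mem (perm_size peo.1).
    by rewrite size_enum_ord.
  by apply/levelP/weighted_coverP => h' a b Dab; have := h' a b Dab; rewrite ?lt //; apply.
- case=> fs [sz [_ [reg n1]]]; apply: (bound J fs) => //; first by rewrite sz.
  by apply: chain_wreg => //; apply/wregP.
Qed.
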